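(* Let $C=(C_\bullet,d,S,T)$ and $\bar C=(\bar C_\bullet,d,S,T)$ be para-$S$-modules of $k$-modules. Let $f:C_\bullet\to\bar C_\bullet$ and $g:\bar C_\bullet\to C_\bullet$ be $S$-maps such that $$fg=1+d\psi+\psi d,\qquad gf=1+d\varphi+\varphi d,$$ where $\varphi:C_\bullet\to C_{\bullet+1}$ and $\psi:\bar C_\bullet\to\bar C_{\bullet+1}$ are $k$-linear maps commuting with $S$ and $T$. Then $$f^\sharp g^\sharp=1+d\psi^\sharp+\psi^\sharp d,\qquad g^\sharp f^\sharp=1+d\varphi^\sharp+\varphi^\sharp d .$$ In particular this gives a $T$-homotopy equivalence between the periodic para-complexes $C^\sharp$ and $\bar C^\sharp$, and it is a deformation retract (that is, $f^\sharp g^\sharp=1$) when $fg=1$.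
   Context: $k$ is a unital ring, not assumed commutative; $k$-modules are left modules. A para-$S$-module $(C_\bullet,d,S,T)$ consists of $k$-modules $C_m$ ($m\ge 0$; $C_m=0$ for $m<0$), $k$-linear maps $d:C_\bullet\to C_{\bullet-1}$, $S:C_\bullet\to C_{\bullet-2}$ and a $k$-linear isomorphism $T:C_\bullet\to C_\bullet$ such that $d^2=S(1-T)$ and $d,S,T$ commute pairwise. An $S$-map between para-$S$-modules is a degree $0$ $k$-linear map commuting with $d$, $S$ and $T$. Periodic para-complex: for $m\geq 0$ let $C_m^\sharp=\{(x_{m+2q})_{q\ge 0}: x_{m+2q}\in C_{m+2q},\ Sx_{m+2q+2}=x_{m+2q}\ \forall q\}$. The shift $(x_m,x_{m+2},\ldots)\mapsto(x_{m+2},x_{m+4},\ldots)$ identifies $C_m^\sharp\simeq C_{m+2}^\sharp$. With this identification, $C^\sharp=(C_0^\sharp\oplus C_1^\sharp,d,T)$ is the $\mathbb Z/2$-graded module with odd operator $d$ and even automorphism $T$ induced componentwise from $d$ and $T$; thus $d(x_0,x_2,\ldots)=(dx_2,dx_4,\ldots)$ and $d(x_1,x_3,\ldots)=(dx_1,dx_3,\ldots)$. It satisfies $d^2=1-T$. Any $k$-linear map $h:C_\bullet\to\bar C_{\bullet+e}$ ($e\in\mathbb Z$) commuting with $S$ and $T$ induces componentwise a $T$-compatible map $h^\sharp:C^\sharp\to\bar C^\sharp$, which is even or odd according to the parity of $e$. A $T$-homotopy equivalence is a homotopy equivalence (for the operators $d$) in which all the maps and homotopies commute with $T$. *)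

(* Defs.v *)
From HB Require Import structures.
From mathcomp Require Import all_boot all_order all_algebra.
From mathcomp Require Import zify ring.
From mathcomp Require Import boolp.

Set Implicit Arguments.
Unset Strict Implicit.
Unset Printing Implicit Defensive.
Import Order.TTheory GRing.Theory Num.Theory.
Local Open Scope ring_scope.

(* A k-linear map of degree e between modules graded by an abelian group I
   (below I is int or 'Z_2) is given by all its matrix entries C m -> D n, the
   entries with n <> m + e being zero.  This avoids transports along equalities
   of degrees: equations between maps are stated entrywise. *)
Section GradedMaps.
Variables (k : pzRingType) (I : zmodType).
Implicit Types C D E : I -> lmodType k.

Record gmap C D (e : I) := GMap {
  gmap_entry :> forall m n : I, {linear C m -> D n};
  gmap_off : forall m n, n <> m + e -> forall x, gmap_entry m n x = 0
}.

Lemma gcomp_off C D E e2 e1 (h2 : gmap D E e2) (h1 : gmap C D e1) m n :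
  n <> m + (e1 + e2) -> forall x, (h2 (m + e1) n \o h1 m (m + e1)) x = 0.
Proof. by rewrite addrA => ne x /=; rewrite gmap_off. Qed.

Definition gcomp C D E e2 e1 (h2 : gmap D E e2) (h1 : gmap C D e1) :
    gmap C E (e1 + e2) :=
  GMap (gmap_entry := fun m n => (h2 (m + e1) n \o h1 m (m + e1))%FUN)
       (gcomp_off h2 h1).

Lemma gcompE C D E e2 e1 (h2 : gmap D E e2) (h1 : gmap C D e1) m p n x :
  p = m + e1 -> gcomp h2 h1 m n x = h2 p n (h1 m p x).
Proof. by move=> ->. Qed.

(* The identity, as a map of degree 0. *)
Definition gid_fun C (m n : I) : C m -> C n :=
  if m =P n is ReflectT e then fun x => ecast z (C z) e x else fun=> 0.

Lemma gid_fun_linear C m n : linear (@gid_fun C m n).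
Proof.
rewrite /gid_fun; case: eqP => [e|_] a x y; last by rewrite scaler0 addr0.
by case: n / e.
Qed.

HB.instance Definition _ C m n :=
  GRing.isLinear.Build k (C m) (C n) *:%R (@gid_fun C m n) (@gid_fun_linear C m n).

Lemma gid_off C m n : n <> m + 0 -> forall x, @gid_fun C m n x = 0.
Proof.
by rewrite addr0 /gid_fun; case: eqP => // e ne; case: ne.
Qed.

Definition gid C : gmap C C 0 :=
  GMap (gmap_entry := fun m n => @gid_fun C m n) (@gid_off C).

Lemma gidE C m x : gid C m m x = x.
Proof. by rewrite /= /gid_fun; case: eqP => // e; rewrite eq_axiomK. Qed.

(* h A = A' h *)
Definition intertwines C D a e (A : gmap C C a) (A' : gmap D D a)
    (h : gmap C D e) : Prop :=
  forall m n x, gcomp h A m n x = gcomp A' h m n x.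

(* h = 1 *)
Definition is_identity C (e : I) (h : gmap C C e) : Prop :=
  forall m n x, h m n x = gid C m n x.

(* h = 1 + d u + u d *)
Definition is_identity_up_to C (e a b : I) (d : gmap C C a) (h : gmap C C e)
    (u : gmap C C b) : Prop :=
  forall m n x, h m n x = gid C m n x + gcomp d u m n x + gcomp u d m n x.

End GradedMaps.
Arguments gid {k I} C.

Record paraSModule (k : pzRingType) := ParaSModule {
  psm_mod :> int -> lmodType k;
  psm_neg : forall m, m < 0 -> forall x : psm_mod m, x = 0;
  psm_d : gmap psm_mod psm_mod (-1);
  psm_S : gmap psm_mod psm_mod (-2);
  psm_T : gmap psm_mod psm_mod 0;
  psm_T_bij : forall m, bijective (psm_T m m);
  psm_dd : forall m n x,
    gcomp psm_d psm_d m n x = psm_S m n (x - psm_T m m x);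
  psm_dS : intertwines psm_S psm_S psm_d;
  psm_dT : intertwines psm_T psm_T psm_d;
  psm_ST : intertwines psm_T psm_T psm_S
}.

Record STmap (k : pzRingType) (C D : paraSModule k) (e : int) := STMap {
  st_map :> gmap C D e;
  st_S : intertwines (psm_S C) (psm_S D) st_map;
  st_T : intertwines (psm_T C) (psm_T D) st_map
}.

Record Smap (k : pzRingType) (C D : paraSModule k) := SMap {
  s_map :> STmap C D 0;
  s_d : intertwines (psm_d C) (psm_d D) s_map
}.

Record paraComplex (k : pzRingType) := ParaComplex {
  pc_mod :> 'Z_2 -> lmodType k;
  pc_d : gmap pc_mod pc_mod 1;
  pc_T : gmap pc_mod pc_mod 0;
  pc_T_bij : forall i, bijective (pc_T i i);
  pc_dd : forall i j x, gcomp pc_d pc_d i j x = gid pc_mod i j x - pc_T i j x;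
  pc_dT : intertwines pc_T pc_T pc_d
}.

Section SharpModule.
Variables (k : pzRingType) (C : paraSModule k) (m : nat).

(* C_m^# *)
Record csharp := CSharp {
  cs_seq :> forall q : nat, C (m + 2 * q)%N;
  cs_S : forall q, psm_S C (m + 2 * q.+1)%N (m + 2 * q)%N (cs_seq q.+1) = cs_seq q
}.

Lemma csharp_eq (x y : csharp) : (forall q, x q = y q) -> x = y.
Proof.
case: x y => [x xS] [y yS] /= exy.
have {exy} exy : x = y by exact: functional_extensionality_dep.
by subst y; congr CSharp; exact: Prop_irrelevance.
Qed.

HB.instance Definition _ := gen_eqMixin csharp.
HB.instance Definition _ := gen_choiceMixin csharp.

Let Sq q := psm_S C (m + 2 * q.+1)%N (m + 2 * q)%N.

Lemma csharp0_S q : Sq q 0 = 0.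
Proof. exact: raddf0. Qed.
Lemma csharp_opp_S (x : csharp) q : Sq q (- x q.+1) = - x q.
Proof. by rewrite [LHS]raddfN; congr (- _); exact: cs_S. Qed.
Lemma csharp_add_S (x y : csharp) q : Sq q (x q.+1 + y q.+1) = x q + y q.
Proof. by rewrite [LHS]raddfD; congr (_ + _); exact: cs_S. Qed.
Lemma csharp_scale_S (a : k) (x : csharp) q : Sq q (a *: x q.+1) = a *: x q.
Proof. by rewrite [LHS]linearZ_LR; congr (_ *: _); exact: cs_S. Qed.

Definition csharp0 := @CSharp (fun=> 0) csharp0_S.
Definition csharp_opp x := CSharp (csharp_opp_S x).
Definition csharp_add x y := CSharp (csharp_add_S x y).
Definition csharp_scale a x := CSharp (csharp_scale_S a x).

Lemma csharp_addA : associative csharp_add.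
Proof. by move=> x y z; apply: csharp_eq => q /=; rewrite addrA. Qed.
Lemma csharp_addC : commutative csharp_add.
Proof. by move=> x y; apply: csharp_eq => q /=; rewrite addrC. Qed.
Lemma csharp_add0 : left_id csharp0 csharp_add.
Proof. by move=> x; apply: csharp_eq => q /=; rewrite add0r. Qed.
Lemma csharp_addN : left_inverse csharp0 csharp_opp csharp_add.
Proof. by move=> x; apply: csharp_eq => q /=; rewrite addNr. Qed.

HB.instance Definition _ :=
  GRing.isZmodule.Build csharp csharp_addA csharp_addC csharp_add0 csharp_addN.

Lemma csharp_scaleA a b x : csharp_scale a (csharp_scale b x) = csharp_scale (a * b) x.
Proof. by apply: csharp_eq => q /=; rewrite scalerA. Qed.
Lemma csharp_scale1 : left_id 1 csharp_scale.
Proof. by move=> x; apply: csharp_eq => q /=; rewrite scale1r. Qed.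
Lemma csharp_scaleDr : right_distributive csharp_scale +%R.
Proof. by move=> a x y; apply: csharp_eq => q /=; rewrite scalerDr. Qed.
Lemma csharp_scaleDl x : {morph csharp_scale^~ x : a b / a + b}.
Proof. by move=> a b; apply: csharp_eq => q /=; rewrite scalerDl. Qed.

HB.instance Definition _ := GRing.Zmodule_isLmodule.Build k csharp
  csharp_scaleA csharp_scale1 csharp_scaleDr csharp_scaleDl.

(* The entry of x of degree n : int, zero if x has none. *)
Definition cs_at (n : int) (x : csharp) : C n :=
  let q := ((`|n| - m)./2)%N in gid C (m + 2 * q)%N n (x q).

Lemma cs_at_linear n : linear (cs_at n).
Proof. by move=> a x y; rewrite /cs_at /= -linearP. Qed.

HB.instance Definition _ n :=
  GRing.isLinear.Build k csharp (C n) *:%R (cs_at n) (cs_at_linear n).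

Lemma cs_atE q x : cs_at (m + 2 * q)%N x = x q.
Proof.
rewrite /cs_at; have -> : ((`|(m + 2 * q)%N| - m)./2 = q)%N by lia.
exact: gidE.
Qed.

Lemma cs_at_off (n : int) x :
  (forall q : nat, n <> (m + 2 * q)%N) -> cs_at n x = 0.
Proof. by move=> nq; apply: gmap_off; rewrite addr0; apply: nq. Qed.

End SharpModule.

(* Degrees of C^# are classes mod 2; nat_of_ord i is 0 or 1 for i : 'Z_2. *)
Definition csharp2 (k : pzRingType) (C : paraSModule k) (i : 'Z_2) : lmodType k :=
  csharp C i.

(* |e| rather than e makes parity (-1) convertible to 1, the degree of pc_d. *)
Definition parity (e : int) : 'Z_2 := `|e|%N%:R.

Lemma cs_at_parity (k : pzRingType) (C : paraSModule k) (i j : 'Z_2) (e n : int)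
    (q : nat) (x : csharp C i) :
  n = (j + 2 * q)%N%:Z - e -> j <> i + parity e -> cs_at n x = 0.
Proof.
move=> -> nj; apply: cs_at_off => p ep; apply: nj; apply: val_inj => /=.
have ep' : (j + 2 * q)%N%:Z = (i + 2 * p)%N%:Z + e by rewrite -ep; ring.
have i2 : (i < 2)%N := ltn_ord i; have j2 : (j < 2)%N := ltn_ord j.
rewrite /parity Zp_nat /=; change (Zp_trunc 2).+2 with 2%N.
move: {ep x} (nat_of_ord i) (nat_of_ord j) i2 j2 ep' => {}i {}j i2 j2 ep; lia.
Qed.

Section SharpMap.
Variables (k : pzRingType) (C : paraSModule k).

Lemma cs_at_S (i : 'Z_2) (x : csharp C i) (n n' : int) :
  n' = n + 2 -> psm_S C n' n (cs_at n' x) = cs_at n x.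
Proof.
move=> def_n'.
case: (pselect (exists q : nat, n' = (i + 2 * q)%N)) => [[[|q] n'q]|noq].
- suff n0 : n < 0 by rewrite [LHS](psm_neg n0 _) [RHS](psm_neg n0 _).
  by have i2 : (i < 2)%N := ltn_ord i; lia.
- have nq : n = (i + 2 * q)%N by lia.
  by rewrite n'q nq !cs_atE cs_S.
- rewrite !cs_at_off ?raddf0 // => q nq; apply: noq.
    by exists q.+1; lia.
  by exists q.
Qed.

Variables (D : paraSModule k) (e : int) (h : STmap C D e).

Definition sharp_seq (i j : 'Z_2) (x : csharp2 C i) (q : nat) : D (j + 2 * q)%N :=
  h ((j + 2 * q)%N%:Z - e) (j + 2 * q)%N (cs_at ((j + 2 * q)%N%:Z - e) x).

Lemma sharp_seq_S (i j : 'Z_2) (x : csharp2 C i) q :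
  psm_S D (j + 2 * q.+1)%N (j + 2 * q)%N (@sharp_seq i j x q.+1) = @sharp_seq i j x q.
Proof.
rewrite /sharp_seq.
set n := (j + 2 * q)%N; set n' := (j + 2 * q.+1)%N.
have e1 : n'%:Z = n'%:Z - e + e by ring.
rewrite -(gcompE _ _ _ _ e1) -(st_S h).
have e2 : n%:Z - e = n'%:Z - e + -2 by rewrite /n /n'; lia.
by rewrite (gcompE _ _ _ _ e2) cs_at_S // e2; ring.
Qed.

Definition sharp_fun (i j : 'Z_2) (x : csharp2 C i) : csharp2 D j :=
  CSharp (@sharp_seq_S i j x).

Lemma sharp_linear (i j : 'Z_2) : linear (@sharp_fun i j).
Proof.
by move=> a x y; apply: csharp_eq => q; rewrite /= /sharp_seq !linearP.
Qed.

HB.instance Definition _ (i j : 'Z_2) := GRing.isLinear.Build k (csharp2 C i) (csharp2 D j)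
  *:%R (@sharp_fun i j) (@sharp_linear i j).

Lemma sharp_off (i j : 'Z_2) : j <> i + parity e -> forall x, @sharp_fun i j x = 0.
Proof.
move=> nj x; apply: csharp_eq => q; rewrite /= /sharp_seq.
by rewrite (cs_at_parity x (erefl _) nj) raddf0.
Qed.

(* The component of degree n of h^# x is h applied to the component of degree
   n - e of x, which is 0 when n < e.  Modulo the shifts C_m^# ~ C_(m+2)^#, whose
   inverse prepends S x_m, this is (x_m, x_(m+2), ...) |->
   (h x_m, h x_(m+2), ...): when h x_m has degree at least 2, the components
   prepended to it are S (h x_m) = h (S x_m) = 0, etc., as m < 2.  See sharpE. *)
Definition sharp : gmap (csharp2 C) (csharp2 D) (parity e) :=
  GMap (gmap_entry := fun i j => @sharp_fun i j) sharp_off.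

Lemma sharpE (i j : 'Z_2) (x : csharp2 C i) (p q : nat) :
  (j + 2 * q)%N%:Z = (i + 2 * p)%N%:Z + e ->
  (sharp i j x) q = h (i + 2 * p)%N (j + 2 * q)%N (x p).
Proof.
move=> E; rewrite /= /sharp_seq.
have -> : (j + 2 * q)%N%:Z - e = (i + 2 * p)%N by rewrite E; ring.
by rewrite cs_atE.
Qed.

End SharpMap.

Lemma parityD (a b : int) : parity (a + b) = parity a + parity b.
Proof.
apply: val_inj; rewrite /parity /= !Zp_nat /=; change (Zp_trunc 2).+2 with 2%N.
lia.
Qed.

Lemma gcomp_sharpE (k : pzRingType) (C D E : paraSModule k) (e1 e2 : int)
    (h2 : STmap D E e2) (h1 : STmap C D e1) (i j : 'Z_2) (x : csharp C i) (q : nat) (m : int) :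
  (j + 2 * q)%N%:Z = m + (e1 + e2) ->
  (gcomp (sharp h2) (sharp h1) i j x : csharp E j) q =
  gcomp h2 h1 m (j + 2 * q)%N (cs_at m x).
Proof.
move=> def_m; have em : m = (j + 2 * q)%N%:Z - (e1 + e2) by rewrite def_m; ring.
have [jE|/eqP nj] := eqVneq j (i + parity (e1 + e2)); last first.
  rewrite (cs_at_parity x em nj) raddf0 gmap_off //.
  by rewrite -parityD.
set l := i + parity e1.
rewrite (gcompE _ _ _ _ (erefl l)) /= /sharp_seq.
set n := (j + 2 * q)%N.
have <- : n%:Z - e2 = m + e1 by rewrite em /n; ring.
congr (h2 _ _ _).
case: (pselect (exists p : nat, n%:Z - e2 = (l + 2 * p)%N)) => [[p ep]|np].
  rewrite ep cs_atE /= /sharp_seq.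
  by have -> : (l + 2 * p)%N%:Z - e1 = m by rewrite -ep em /n; ring.
rewrite cs_at_off; last by move=> p ep; apply: np; exists p.
have n0 : n%:Z - e2 < 0.
  apply: contra_notT np; rewrite -leNgt => n0.
  have l2 : (l < 2)%N := ltn_ord l; have j2 : (j < 2)%N := ltn_ord j.
  have /(congr1 val) : j = l + parity e2 by rewrite /l jE parityD addrA.
  rewrite /parity Zp_nat /=; change (Zp_trunc 2).+2 with 2%N => jl.
  exists (`|n%:Z - e2| %/ 2)%N; rewrite {}/n in n0 *.
  move: (nat_of_ord l) (nat_of_ord j) l2 j2 jl n0 => l' j' l2 j2 jl n0.
  lia.
by rewrite [RHS](psm_neg n0).
Qed.

Section Periodic.
Variables (k : pzRingType) (C : paraSModule k).

Lemma psm_TS : intertwines (psm_S C) (psm_S C) (psm_T C).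
Proof. by move=> m n x; rewrite psm_ST. Qed.

Definition st_d : STmap C C (-1) := STMap (@psm_dS k C) (@psm_dT k C).
Definition st_Tmap : STmap C C 0 := STMap psm_TS (fun _ _ _ => erefl).

Lemma sharp_TE (i : 'Z_2) (x : csharp2 C i) q :
  (sharp st_Tmap i i x) q = psm_T C (i + 2 * q)%N (i + 2 * q)%N (x q).
Proof. by apply: sharpE; rewrite addr0. Qed.

Lemma sharp_T_bij (i : 'Z_2) : bijective (sharp st_Tmap i i).
Proof.
have Tinj m : injective (psm_T C m m) by apply: bij_inj; exact: psm_T_bij.
have Tsurj m (y : C m) : exists x, psm_T C m m x = y.
  by have [g _ gK] := psm_T_bij C m; exists (g y).
have sj (y : csharp2 C i) : exists x, sharp st_Tmap i i x = y.
  pose t q := sval (cid (Tsurj _ (y q))).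
  have tE q : psm_T C _ _ (t q) = y q := svalP (cid (Tsurj _ (y q))).
  have tS q : psm_S C (i + 2 * q.+1)%N (i + 2 * q)%N (t q.+1) = t q.
    apply: Tinj; rewrite tE -(cs_S y) -tE.
    set n : int := (i + 2 * q)%N; set n' : int := (i + 2 * q.+1)%N.
    have e0 (a : int) : a = a + 0 by rewrite addr0.
    have eS : n = n' + -2 by rewrite /n /n'; lia.
    by rewrite -(gcompE _ _ _ _ eS) -(gcompE (psm_S C) (psm_T C) _ _ (e0 n')) psm_ST.
  by exists (CSharp tS); apply: csharp_eq => q; rewrite sharp_TE tE.
exists (fun y => sval (cid (sj y))) => [x|y]; last exact: svalP (cid (sj y)).
have := svalP (cid (sj (sharp st_Tmap i i x))).
move: (sval _) => z zx; apply: csharp_eq => q; apply: Tinj.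
by rewrite -!sharp_TE zx.
Qed.

Lemma sharp_dd (i j : 'Z_2) (x : csharp2 C i) :
  gcomp (sharp st_d) (sharp st_d) i j x
  = gid (csharp2 C) i j x - sharp st_Tmap i j x.
Proof.
have [<-|/eqP nj] := eqVneq i j; last first.
  have e11 : parity (-1) + parity (-1) = 0 by exact: val_inj.
  have nj0 : j <> i + 0 by rewrite addr0 => ji; apply: nj.
  by rewrite gmap_off ?e11 // !(gmap_off _ nj0) subr0.
apply: csharp_eq => q; set n : int := (i + 2 * q)%N.
have en : n = n + 2 + (-1 + -1) by ring.
rewrite (gcomp_sharpE _ _ _ en) [LHS]psm_dd gidE.
have eS : n = n + 2 + -2 by ring.
set y := cs_at (n + 2) x.
have Sy : psm_S C (n + 2) n y = x q by rewrite cs_at_S // cs_atE.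
rewrite [LHS]raddfB; congr (_ - _); first exact: Sy.
have e0 (a : int) : a = a + 0 by rewrite addr0.
rewrite -[LHS](gcompE (psm_S C) (psm_T C) _ _ (e0 _)) psm_ST.
by rewrite (gcompE _ _ _ _ eS) Sy sharp_TE.
Qed.

Lemma sharp_dT : intertwines (sharp st_Tmap) (sharp st_Tmap) (sharp st_d).
Proof.
move=> i j x; apply: csharp_eq => q; set n : int := (j + 2 * q)%N.
have e1 : n = n + 1 + (0 + -1) by ring.
have e2 : n = n + 1 + (-1 + 0) by ring.
by rewrite (gcomp_sharpE _ _ _ e1) (gcomp_sharpE _ _ _ e2) [LHS]psm_dT.
Qed.

(* With C_m^# identified to C_(m+2)^# by the shift, these are
   d (x_0, x_2, ...) = (d x_2, d x_4, ...) and
   d (x_1, x_3, ...) = (d x_1, d x_3, ...). *)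
Lemma sharp_d0E (x : csharp C 0%N) q :
  (sharp st_d 0 1 x : csharp C 1%N) q = psm_d C (0 + 2 * q.+1)%N (1 + 2 * q)%N (x q.+1).
Proof.
have E : (1 + 2 * q)%N%:Z = (0 + 2 * q.+1)%N%:Z + -1 by lia.
exact: (@sharpE _ _ _ _ st_d 0 1 x q.+1 q E).
Qed.

Lemma sharp_d1E (x : csharp C 1%N) q :
  (sharp st_d 1 0 x : csharp C 0%N) q = psm_d C (1 + 2 * q)%N (0 + 2 * q)%N (x q).
Proof.
have E : (0 + 2 * q)%N%:Z = (1 + 2 * q)%N%:Z + -1 by lia.
exact: (@sharpE _ _ _ _ st_d 1 0 x q q E).
Qed.

Definition periodic : paraComplex k :=
  @ParaComplex k (csharp2 C) (sharp st_d) (sharp st_Tmap)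
    sharp_T_bij sharp_dd sharp_dT.

End Periodic.

Section THomotopy.
Variables (k : pzRingType) (X Y : paraComplex k).

Definition T_homotopy_equivalence (F : gmap X Y 0) (G : gmap Y X 0)
    (Phi : gmap X X 1) (Psi : gmap Y Y 1) : Prop :=
  [/\ intertwines (pc_d X) (pc_d Y) F /\ intertwines (pc_T X) (pc_T Y) F,
      intertwines (pc_d Y) (pc_d X) G /\ intertwines (pc_T Y) (pc_T X) G,
      intertwines (pc_T X) (pc_T X) Phi /\ intertwines (pc_T Y) (pc_T Y) Psi,
      is_identity_up_to (pc_d Y) (gcomp F G) Psi &
      is_identity_up_to (pc_d X) (gcomp G F) Phi].

Definition T_deformation_retract (F : gmap X Y 0) (G : gmap Y X 0)
    (Phi : gmap X X 1) : Prop :=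
  [/\ intertwines (pc_d X) (pc_d Y) F /\ intertwines (pc_T X) (pc_T Y) F,
      intertwines (pc_d Y) (pc_d X) G /\ intertwines (pc_T Y) (pc_T X) G,
      intertwines (pc_T X) (pc_T X) Phi,
      is_identity (gcomp F G) &
      is_identity_up_to (pc_d X) (gcomp G F) Phi].

End THomotopy.

(* Main.v *)
Require Import Defs.
From mathcomp Require Import all_boot all_order all_algebra.
Import GRing.Theory.
Local Open Scope ring_scope.

(** The assignment [h |-> sharp h] is an additive functor.  The component of
    degree [n] of [sharp h x] is [h] applied to the component of degree [n - e]
    of [x], so a composite [sharp h2 (sharp h1 x)] is computed in each degree by
    the composite [h2 h1] ([gcomp_sharpE]), sums are computed componentwise, and
    the identity of the periodic module reads off components ([gid_sharpE]).
    An equation between composites of maps commuting with [S] and [T] therefore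
    passes to the periodic modules: it is evaluated on one component at a time.
    [sharp_intertwines] is this principle for [h A = A' h]; it gives that
    [sharp f] and [sharp g] commute with [d], and that all four maps commute with
    [T].  [sharp_identity] and [sharp_identity_up_to] are the cases [h2 h1 = 1]
    and [h2 h1 = 1 + d u + u d]. *)

(** In the component of degree [n] both sides see only the component of degree
    [n - (a + e)] of the argument, where they are [h A] and [A' h]. *)
Lemma sharp_intertwines (k : pzRingType) (C D : paraSModule k) (a e : int)
    (A : STmap C C a) (A' : STmap D D a) (h : STmap C D e) :
  intertwines A A' h -> intertwines (sharp A) (sharp A') (sharp h).
Proof.
move=> hA i j x; apply: csharp_eq => q.
have n_ae : (j + 2 * q)%N%:Z = (j + 2 * q)%N%:Z - (a + e) + (a + e).
  by rewrite subrK.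
have n_ea : (j + 2 * q)%N%:Z = (j + 2 * q)%N%:Z - (a + e) + (e + a).
  by rewrite [e + a]addrC subrK.
by rewrite (gcomp_sharpE _ _ _ n_ae) (gcomp_sharpE _ _ _ n_ea) hA.
Qed.

Lemma sharp_T (k : pzRingType) (C D : paraSModule k) (e : int)
    (h : STmap C D e) :
  intertwines (sharp (st_Tmap C)) (sharp (st_Tmap D)) (sharp h).
Proof. exact/sharp_intertwines/st_T. Qed.

Lemma sharp_d (k : pzRingType) (C D : paraSModule k) (f : Smap C D) :
  intertwines (sharp (st_d C)) (sharp (st_d D)) (sharp f).
Proof. exact/sharp_intertwines/s_d. Qed.

Lemma gid_sharpE (k : pzRingType) (C : paraSModule k) (i j : 'Z_2)
    (x : csharp2 C i) (q : nat) :
  (gid (csharp2 C) i j x : csharp C j) q = cs_at (j + 2 * q)%N x.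
Proof.
have [<-|/eqP nj] := eqVneq i j; first by rewrite gidE cs_atE.
have nj0 : j <> i + 0 by rewrite addr0 => ji; apply: nj.
by rewrite (gmap_off _ nj0) (@cs_at_parity _ _ _ j 0 _ q) ?subr0.
Qed.

Section Composite.
Variables (k : pzRingType) (C D : paraSModule k) (e1 e2 : int).
Variables (h1 : STmap C D e1) (h2 : STmap D C e2).
Hypothesis e12 : e1 + e2 = 0.

Lemma sharp_identity :
  is_identity (gcomp h2 h1) -> is_identity (gcomp (sharp h2) (sharp h1)).
Proof.
move=> h21 i j x; apply: csharp_eq => q.
rewrite gid_sharpE (@gcomp_sharpE _ _ _ _ _ _ h2 h1 i j x q (j + 2 * q)%N).
  by rewrite h21 gidE.
by rewrite e12 addr0.
Qed.

(** All terms of the equation have total degree 0, so that its component of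
    degree [n] only involves the component of degree [n] of the argument. *)
Lemma sharp_identity_up_to (a b : int) (d : STmap C C a) (u : STmap C C b) :
  a + b = 0 -> is_identity_up_to d (gcomp h2 h1) u ->
  is_identity_up_to (sharp d) (gcomp (sharp h2) (sharp h1)) (sharp u).
Proof.
move=> ab h21 i j x; apply: csharp_eq => q.
have n0 (c : int) : c = 0 -> (j + 2 * q)%N%:Z = (j + 2 * q)%N%:Z + c.
  by move=> ->; rewrite addr0.
have ba : b + a = 0 by rewrite addrC.
rewrite (gcomp_sharpE _ _ _ (n0 _ e12)) h21.
congr (_ + _ + _); first by rewrite gidE -gid_sharpE.
- by rewrite -(gcomp_sharpE _ _ _ (n0 _ ba)).
- by rewrite -(gcomp_sharpE _ _ _ (n0 _ ab)).
Qed.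

End Composite.

Theorem proposition2p9 (k : pzRingType) (C D : paraSModule k)
    (f : Smap C D) (g : Smap D C)
    (phi : STmap C C 1) (psi : STmap D D 1)
    (hfg : is_identity_up_to (psm_d D) (gcomp f g) psi)
    (hgf : is_identity_up_to (psm_d C) (gcomp g f) phi) :
  [/\ is_identity_up_to (pc_d (periodic D)) (gcomp (sharp f) (sharp g)) (sharp psi),
      is_identity_up_to (pc_d (periodic C)) (gcomp (sharp g) (sharp f)) (sharp phi),
      @T_homotopy_equivalence k (periodic C) (periodic D)
        (sharp f) (sharp g) (sharp phi) (sharp psi) &
      is_identity (gcomp f g) ->
        @T_deformation_retract k (periodic C) (periodic D)
          (sharp f) (sharp g) (sharp phi)].
Proof.
have fgE : is_identity_up_to (sharp (st_d D)) (gcomp (sharp f) (sharp g)) (sharp psi).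
  exact: sharp_identity_up_to.
have gfE : is_identity_up_to (sharp (st_d C)) (gcomp (sharp g) (sharp f)) (sharp phi).
  exact: sharp_identity_up_to.
have fdT := conj (sharp_d _ _ _ f) (sharp_T _ _ _ _ f).
have gdT := conj (sharp_d _ _ _ g) (sharp_T _ _ _ _ g).
have phiT := sharp_T _ _ _ _ phi; have psiT := sharp_T _ _ _ _ psi.
split=> [|||fg1].
- exact: fgE.
- exact: gfE.
- by split; [exact: fdT | exact: gdT | split | exact: fgE | exact: gfE].
- have fg1' : is_identity (gcomp (sharp f) (sharp g)) by exact: sharp_identity.
  by split; [exact: fdT | exact: gdT | exact: phiT | exact: fg1' | exact: gfE].
Qed.
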